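(* (The Lifting Property.) Let $1\le k\le n$, $v,w\in\mathcal{W}_{n,k}$ and $i\in[k-1]$ with $\alpha_{i+1}(v)<\alpha_i(v)$ and $\alpha_{i+1}(w)<\alpha_i(w)$. If $v\le w$ in the medium roast Fubini-Bruhat order, then $s_iv\le s_iw$. Furthermore, if $v\rightharpoonup w$, then $s_iv\rightharpoonup s_iw$.
   Context: A Fubini word $w=w_1\cdots w_n\in\mathcal{W}_{n,k}$ is a surjection $w:[n]\to[k]$, $w_j=w(j)$. $\alpha_i(w)$ is the position of the first occurrence of $i$ in $w$, $\mathrm{in}(w)=\{\alpha_1(w),\dots,\alpha_k(w)\}$. $s_iw$ is the word obtained from $w$ by interchanging the letters $i$ and $i+1$ everywhere. Let $\mathcal{F}_{k\times n}(\mathbb{C})$ be the complex $k\times n$ matrices of rank $k$ with no zero column and $X_{n,k}$ its quotient by the right action of invertible diagonal $n\times n$ matrices. $M_w$ is the $k\times n$ matrix with $1$ at $(w_j,j)$ for each $j$, $0$ elsewhere. The pattern matrix $P_w$ is obtained from $M_w$ by replacing the $0$ in position $(w_i,j)$ by $\star$ whenever $i\in\mathrm{in}(w)$, $i<\alpha_{w_j}(w)$, and either ($j\in\mathrm{in}(w)$ and $w_i<w_j$) or $j\notin\mathrm{in}(w)$; $P_w$ also denotes the set of complex matrices obtained by substituting complex numbers for the $\star$'s. With $U$ the $k\times k$ lower unitriangular complex matrices, the PR cell $C_w$ is (the image in $X_{n,k}$ of) $UP_w$, and $\overline{C}_w$ is its Zariski closure in $X_{n,k}$. Medium roast order: $v\le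 w$ iff $C_w\subseteq\overline{C}_v$. Touching: $v\rightharpoonup w$ iff $\overline{C}_v\cap C_w\neq\emptyset$. *)

(* Defs.v *)
From HB Require Import structures.
From mathcomp Require Import all_boot all_order all_algebra perm.
From mathcomp Require Import boolp classical_sets reals complex.
From mathcomp Require mpoly.

Set Implicit Arguments.
Unset Strict Implicit.
Unset Printing Implicit Defensive.

Import GRing.Theory.
Local Open Scope ring_scope.
Local Open Scope quotient_scope.

(* Letters and positions are 0-based: the letter c of [k] is c - 1 in 'I_k and
   the position j of [n] is j - 1 in 'I_n. *)

Section Words.
Variables n k : nat.
Implicit Types w : {ffun 'I_n -> 'I_k}.

Definition fubini w : Prop := forall c : 'I_k, exists j : 'I_n, w j = c.

(* First occurrence of c in w; the junk value n is returned only if c does not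
   occur, hence never on a Fubini word. *)
Definition alpha w (c : 'I_k) : nat := index c (codom w).

Definition initial w : {set 'I_n} := [set j : 'I_n | [exists c, alpha w c == j]].

(* s_i w is swap i i' w where i' is the letter following i. *)
Definition swap (i i' : 'I_k) w : {ffun 'I_n -> 'I_k} :=
  [ffun j => tperm i i' (w j)].

Lemma swap_fubini i i' w : fubini w -> fubini (swap i i' w).
Proof.
move=> fw c; have [j wj] := fw (tperm i i' c).
by exists j; rewrite ffunE wj tpermK.
Qed.

Definition star w (r : 'I_k) (j : 'I_n) : bool :=
  (r != w j) &&
  [exists i in initial w,
    [&& r == w i, (i < alpha w (w j))%N &
        (j \in initial w) && (w i < w j)%N || (j \notin initial w)]].

End Words.

Section Cells.
Variables (R : realType) (k n : nat).
Notation C := (R[i]).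
Implicit Types v w : {ffun 'I_n -> 'I_k}.

Definition word_mx w : 'M[C]_(k, n) := \matrix_(r, j) (r == w j)%:R.

Definition pattern w : set 'M[C]_(k, n) :=
  [set A | forall r j, ~~ star w r j -> A r j = word_mx w r j].

Definition lower_unitriangular : set 'M[C]_k :=
  [set u | is_trig_mx u /\ forall r, u r r = 1].

Definition in_F (A : 'M[C]_(k, n)) : bool := (\rank A == k) && [forall j, col j A != 0].

Definition Fkn : Type := {A : 'M[C]_(k, n) | in_F A}.
HB.instance Definition _ := Choice.on Fkn.

Definition torus_eqb (A B : Fkn) : bool :=
  `[< exists D : 'M[C]_n,
        [/\ is_diag_mx D, D \in unitmx & val B = val A *m D] >].

Lemma torus_eqb_refl : reflexive torus_eqb.
Proof.
move=> A; apply/asboolP; exists 1%:M; split; last by rewrite mulmx1.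
- exact: scalar_mx_is_diag.
- exact: unitmx1.
Qed.

Lemma torus_eqb_sym : symmetric torus_eqb.
Proof.
suff H A B : torus_eqb A B -> torus_eqb B A by move=> A B; apply/idP/idP; apply: H.
move=> /asboolP[D [/diag_mxP[d ->] Du AB]]; apply/asboolP.
exists (invmx (diag_mx d)); split; last 2 first.
- by rewrite unitmx_inv.
- by rewrite AB mulmxK.
have d0 j : d 0 j != 0.
  move: Du; rewrite unitmxE det_diag unitfE => /prodf_neq0; exact.
have -> : invmx (diag_mx d) = diag_mx (\row_j (d 0 j)^-1).
  apply: (can_inj (mulKmx Du)); rewrite mulmxV // mulmx_diag.
  rewrite -diag_const_mx; congr diag_mx; apply/rowP => j.
  by rewrite !mxE mulfV.
exact: diag_mx_is_diag.
Qed.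

Lemma torus_eqb_trans : transitive torus_eqb.
Proof.
move=> B A E /asboolP[D [/diag_mxP[d ->] Du AB]].
move=> /asboolP[D' [/diag_mxP[d' ->] D'u BE]]; apply/asboolP.
exists (diag_mx d *m diag_mx d'); split.
- by rewrite mulmx_diag diag_mx_is_diag.
- by rewrite unitmx_mul Du.
- by rewrite BE AB mulmxA.
Qed.

Canonical torus_eq :=
  EquivRel torus_eqb torus_eqb_refl torus_eqb_sym torus_eqb_trans.

Definition Xkn : Type := {eq_quot torus_eq}.
HB.instance Definition _ := Choice.on Xkn.
HB.instance Definition _ := EqQuotient.on Xkn.

(* The Zariski topology of Xkn is the quotient of the Zariski topology of Fkn, the
   latter being induced by the affine space of k x n matrices; polynomials have
   one variable per matrix entry, ordered as in mxvec. *)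
Definition zariski_closed (Z : set Xkn) : Prop :=
  exists S : set (mpoly.mpoly (k * n) C),
    forall A : Fkn, Z (\pi_Xkn A) <->
      forall p, S p -> mpoly.meval (fun t => mxvec (val A) 0 t) p = 0.

Definition zariski_closure (Z : set Xkn) : set Xkn := smallest zariski_closed Z.

(* For w Fubini, U P_w lies in Fkn: the columns of any element of P_w at the
   initial positions, ordered by their letters, form an upper unitriangular
   matrix. *)
Definition PR_cell w : set Xkn :=
  [set x | exists (u : 'M[C]_k) (P : 'M[C]_(k, n)) (A : Fkn),
     [/\ lower_unitriangular u, pattern w P, val A = u *m P & x = \pi_Xkn A]].

Definition medium_roast_le v w : Prop :=
  (PR_cell w `<=` zariski_closure (PR_cell v))%classic.

Definition touches v w : Prop :=
  (zariski_closure (PR_cell v) `&` PR_cell w !=set0)%classic.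

End Cells.

(* Main.v *)
(* Let U be the lower unitriangular group, s = s_i the permutation matrix, and
   x(t) the elementary matrix adding t times row i to row i + 1.  If
   alpha_(i+1)(w) < alpha_i(w), then C_(s_i w) = U s C_w: every u in U factors
   as u = u' x(t) = x(t) u'' with u', u'' having a zero in position (i + 1, i),
   so that s u' s and s u'' s stay in U, while s x(t) P_w lies in P_(s_i w) and
   every element of P_(s_i w) has this form for some t.  Left multiplication by
   an invertible matrix is a homeomorphism of X_(n,k) for the Zariski topology,
   so both C_w <= closure of C_v and the nonemptiness of their intersection
   pass from (v, w) to (s_i v, s_i w). *)
Require Import Defs.
From mathcomp Require Import all_boot all_order all_algebra.
From mathcomp Require Import reals zify.
From mathcomp Require Import perm boolp classical_sets complex.
From mathcomp Require Import mpoly.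

Set Implicit Arguments.
Unset Strict Implicit.
Unset Printing Implicit Defensive.

Import GRing.Theory.
Local Open Scope ring_scope.
Local Open Scope quotient_scope.

(** * First occurrences and stars of a pattern under a letter swap *)

Section Words.
Variables n k : nat.
Implicit Types w : {ffun 'I_n -> 'I_k}.

Lemma letter_of_alpha w c (j : 'I_n) : alpha w c = j -> w j = c.
Proof.
move=> wcj; have cw : c \in codom w.
  by rewrite -index_mem size_codom card_ord -/(alpha w c) wcj.
have := nth_index c cw; rewrite -/(alpha w c) wcj codomE.
by rewrite (nth_map j) ?nth_ord_enum // size_enum_ord.
Qed.

Lemma alpha_is_position w c : fubini w -> exists j : 'I_n, alpha w c = j.
Proof.
move=> /(_ c)[j wj].
have lt_n : (alpha w c < n)%N.
  by rewrite -[X in (_ < X)%N]card_ord -(size_codom w) index_mem -wj codom_f.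
by exists (Ordinal lt_n).
Qed.

Lemma in_initial w j : (j \in initial w) = (alpha w (w j) == j).
Proof.
rewrite inE; apply/existsP/idP => [[c /eqP wcj]|]; last by exists (w j).
by rewrite (letter_of_alpha wcj) wcj.
Qed.

(** The initial position required by [star] can only be the first occurrence of [r], and [r != w j]
    follows from the strict inequality between first occurrences. *)
Lemma starE w r j : fubini w ->
  star w r j = (alpha w r < alpha w (w j))%N
               && ((alpha w (w j) == j) ==> (r < w j)%N).
Proof.
move=> fw; rewrite /star in_initial; apply/andP/andP.
- case=> _ /existsP[l /and4P[lw /eqP-> lt_l]].
  rewrite in_initial in lw; rewrite (eqP lw) => H; split=> //.
  by move: H; case: eqP => //=; rewrite orbF.
- case=> lt_r H; split; first by apply: contraTneq lt_r => ->; rewrite ltnn.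
  have [l rl] := alpha_is_position r fw; have wl := letter_of_alpha rl.
  apply/existsP; exists l; rewrite in_initial wl rl !eqxx -rl lt_r /=.
  by move: H; case: eqP => //= _ ->.
Qed.

Lemma alpha_swap w i i' c : alpha (swap i i' w) c = alpha w (tperm i i' c).
Proof.
rewrite /alpha -(index_map (@perm_inj _ (tperm i i')) (codom w)) tpermK.
rewrite !codomE; congr index; rewrite -[RHS]map_comp.
by apply: eq_map => j; rewrite ffunE.
Qed.

Lemma star_swap w i i' r j : fubini w ->
  star (swap i i' w) r j = (alpha w (tperm i i' r) < alpha w (w j))%N
     && ((alpha w (w j) == j) ==> (r < tperm i i' (w j))%N).
Proof.
by move=> fw; rewrite (starE _ _ (swap_fubini _ _ fw)) !alpha_swap ffunE tpermK.
Qed.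

End Words.

Section SimpleTransposition.
Variables (k : nat) (i i' : 'I_k).
Hypothesis succ_i : i' = i.+1 :> nat.

(** No letter lies strictly between [i] and [i'], so only this pair changes order. *)
Lemma tperm_ltn (r c : 'I_k) : (r < c)%N -> (r != i) || (c != i') ->
  (tperm i i' r < tperm i i' c)%N.
Proof.
move=> rc; rewrite -!val_eqE /= => H.
by rewrite !permE /= -!val_eqE /=; do ![case: ifP]; lia.
Qed.

End SimpleTransposition.

(** * Left multiplication by invertible matrices on [Xkn] and its Zariski continuity *)

Section LeftAction.
Variables (R : realType) (k n : nat).
Notation C := (R[i]).
Implicit Types (g : 'M[C]_k) (A B : Fkn R k n).

Lemma in_F_mull g (A : 'M[C]_(k, n)) : g \in unitmx -> in_F A -> in_F (g *m A).
Proof.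
move=> ug /andP[/eqP rA /forallP cA]; apply/andP; split.
  by rewrite (eqmxMfull A) ?row_full_unit // rA.
apply/forallP => j; apply: contra (cA j) => /eqP gA0.
by rewrite -[A](mulKmx ug) colE -mulmxA -colE gA0 mulmx0.
Qed.

Definition lact g (ug : g \in unitmx) A : Fkn R k n :=
  exist _ (g *m val A) (in_F_mull ug (valP A)).

Lemma lact_pi g (ug : g \in unitmx) A B :
  \pi_(Xkn R k n) A = \pi_(Xkn R k n) B ->
  \pi_(Xkn R k n) (lact ug A) = \pi_(Xkn R k n) (lact ug B).
Proof.
move=> /eqmodP/asboolP[D [dD uD BAD]]; apply/eqmodP/asboolP; exists D.
by split=> //=; rewrite [sval B]BAD mulmxA.
Qed.

(** This is the preimage of [W] under left multiplication; by [lact_pi] the choice of [repr] is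
    harmless. Its equations are those of [W] with the entries of [g *m A] substituted as linear
    forms in the entries of [A]. *)
Lemma zariski_closed_lact g (ug : g \in unitmx) (W : set (Xkn R k n)) :
  zariski_closed W ->
  zariski_closed [set x | W (\pi_(Xkn R k n) (lact ug (repr x)))].
Proof.
move=> [S WS].
pose sub := [tuple \sum_s lin_mulmx g s t *: 'X_s | t < (k * n)%N].
exists [set comp_mpoly sub p | p in S]%classic => A /=.
have -> : \pi_(Xkn R k n) (lact ug (repr (\pi_(Xkn R k n) A))) =
          \pi_(Xkn R k n) (lact ug A).
  by apply: lact_pi; rewrite reprK.
have ev p : meval (fun t => mxvec (val A) 0 t) (comp_mpoly sub p) =
            meval (fun t => mxvec (val (lact ug A)) 0 t) p.
  rewrite comp_mpoly_meval; apply: meval_eq => t.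
  rewrite tnth_mktuple raddf_sum /= -[X in mxvec (_ *m X)]mxvecK.
  rewrite -mul_rV_lin mxE; apply: eq_bigr => s _.
  by rewrite mevalZ mevalXU mulrC.
split=> [WA _ [p Sp <-]|H]; first by rewrite ev; apply: (proj1 (WS _)).
by apply: (proj2 (WS _)) => p Sp; rewrite -ev; apply: H; exists p.
Qed.

(** The preimage of a closed set containing [Y] is closed and contains [Z], hence contains the
    closure of [Z]. *)
Lemma zariski_closure_lact g (ug : g \in unitmx) (Y Z : set (Xkn R k n)) :
  (forall A, Z (\pi_(Xkn R k n) A) -> Y (\pi_(Xkn R k n) (lact ug A))) ->
  forall A, zariski_closure Z (\pi_(Xkn R k n) A) ->
            zariski_closure Y (\pi_(Xkn R k n) (lact ug A)).
Proof.
move=> ZY A clZ W [cW YW].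
have /= := clZ _ (conj (zariski_closed_lact ug cW) _).
rewrite (_ : \pi_(Xkn R k n) (lact ug (repr _)) = \pi_(Xkn R k n) (lact ug A)).
  by apply=> x Zx; apply/YW/ZY; rewrite reprK.
by apply: lact_pi; rewrite reprK.
Qed.

End LeftAction.

(** * The action of [U] and of [s] on patterns and PR cells *)

Section Cells.
Variables (R : realType) (k n : nat).
Notation C := (R[i]).
Implicit Types (u : 'M[C]_k) (w : {ffun 'I_n -> 'I_k}) (A B : Fkn R k n).

Lemma lower_unitriangularM u u' :
  lower_unitriangular u -> lower_unitriangular u' ->
  lower_unitriangular (u *m u').
Proof.
move=> [/is_trig_mxP tu du] [/is_trig_mxP tu' du']; split.
  apply/is_trig_mxP => r c rc; rewrite mxE big1 // => s _.
  case: (ltnP r s) => [rs|sr]; first by rewrite tu ?mul0r.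
  by rewrite tu' ?mulr0 // (leq_ltn_trans sr).
move=> r; rewrite mxE (bigD1 r) //= du du' mulr1 big1 ?addr0 // => s.
rewrite neq_ltn => /orP[sr|rs]; first by rewrite tu' ?mulr0.
by rewrite tu ?mul0r.
Qed.

Lemma lower_unitriangular_unitmx u : lower_unitriangular u -> u \in unitmx.
Proof.
by move=> [tu du]; rewrite unitmxE det_trig // big1 ?unitr1.
Qed.

Lemma PR_cell_lact u (uu : u \in unitmx) w A : lower_unitriangular u ->
  PR_cell w (\pi_(Xkn R k n) A) -> PR_cell w (\pi_(Xkn R k n) (lact uu A)).
Proof.
move=> lu [u' [P [B [lu' PP BE AB]]]].
exists (u *m u'), P, (lact uu B); split=> //.
- exact: lower_unitriangularM.
- by rewrite /= BE mulmxA.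
- exact: lact_pi.
Qed.

Variables (i i' : 'I_k).
Hypothesis succ_i : i' = i.+1 :> nat.

Local Notation s := (tperm_mx i i' : 'M[C]_k).

Lemma tperm_mxK : s *m s = 1%:M.
Proof. by rewrite -perm_mxM tperm2 perm_mx1. Qed.

Lemma tperm_mxE m (A : 'M[C]_(k, m)) r j : (s *m A) r j = A (tperm i i' r) j.
Proof. by rewrite -row_permE mxE. Qed.

(** Conjugation by [s] makes this one-parameter subgroup of [U] upper triangular: it is the part of
    [U] that cannot cross [s]. *)
Definition row_op (t : C) : 'M[C]_k := 1%:M + t *: delta_mx i' i.

Lemma row_opE m (A : 'M[C]_(k, m)) t r j :
  (row_op t *m A) r j = A r j + (r == i')%:R * t * A i j.
Proof.
rewrite mulmxDl mul1mx -scalemxAl mxE; congr (_ + _); rewrite mxE mxE.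
rewrite (bigD1 i) //= mxE eqxx andbT big1 ?addr0 => [|l li].
  by rewrite mulrA [t * _]mulrC.
by rewrite mxE (negPf li) andbF mul0r.
Qed.

Lemma row_opK t : row_op t *m row_op (- t) = 1%:M.
Proof.
apply/matrixP => r c; rewrite row_opE !mxE.
have -> : (i == i') = false by rewrite -val_eqE /= succ_i ltn_eqF.
rewrite /= mulr0 addr0 [i == c]eq_sym.
by case: (r == i'); case: (c == i);
  rewrite ?(mulr1, mulr0, mul1r, mul0r, addr0, addrNK).
Qed.

Lemma row_op_lower_unitriangular t : lower_unitriangular (row_op t).
Proof.
split=> [|r]; last first.
  rewrite !mxE eqxx; case: eqP => [->|_]; last by rewrite mulr0 addr0.
  by rewrite -val_eqE /= succ_i gtn_eqF // mulr0 addr0.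
apply/is_trig_mxP => r c rc; rewrite !mxE -!val_eqE /= (ltn_eqF rc).
case: eqP => [ri|_]; last by rewrite mulr0 addr0.
by rewrite gtn_eqF ?mulr0 ?addr0 // -ltnS -succ_i -ri ltnW.
Qed.

(** Conjugation permutes the entries, and [(i', i)] is the only position below the diagonal that is
    sent above it. *)
Lemma conj_lower_unitriangular u : lower_unitriangular u -> u i' i = 0 ->
  lower_unitriangular (s *m u *m s).
Proof.
move=> [/is_trig_mxP tu du] u0.
have susE r c : (s *m u *m s) r c = u (tperm i i' r) (tperm i i' c).
  by rewrite -mulmxA tperm_mxE /tperm_mx -tpermV -col_permE mxE !tpermV.
split=> [|r]; last by rewrite susE du.
apply/is_trig_mxP => r c rc; rewrite susE.
have [/andP[/eqP-> /eqP->]|nrc] := boolP ((r == i) && (c == i')).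
  by rewrite tpermL tpermR u0.
by apply/tu/tperm_ltn; rewrite // -negb_and.
Qed.

(** Outside row [i] of the product the row operation is invisible and [s] carries stars to stars. A
    fixed position in row [i] lies in a column where [P] has no star in rows [i] and [i'] and no 1
    in row [i], so the added multiple is zero. *)
Lemma pattern_swap w t (P : 'M[C]_(k, n)) : fubini w ->
  (alpha w i' < alpha w i)%N -> pattern w P ->
  pattern (swap i i' w) (s *m (row_op t *m P)).
Proof.
move=> fw desc PP r j; rewrite star_swap // => nst.
rewrite tperm_mxE row_opE mxE ffunE.
have -> : (r == tperm i i' (w j)) = (tperm i i' r == w j).
  by rewrite -(inj_eq (@perm_inj _ (tperm i i'))) tpermK.
have PE q : ~~ star w q j -> P q j = (q == w j)%:R by move/PP=> ->; rewrite mxE.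
have [ri|nri] := eqVneq (tperm i i' r) i'; last first.
  rewrite /= !mul0r addr0 PE // starE //; apply: contra nst => /andP[lt_r init].
  rewrite lt_r; apply/implyP => /(implyP init) rwj.
  rewrite -[r](tpermK i i') tperm_ltn // -negb_and.
  (* The reversed pair would put the first [i] before the first [i']. *)
  by apply: contraL lt_r => /andP[/eqP-> /eqP->]; rewrite -leqNgt ltnW.
have {ri} ri : r = i by rewrite -[r](tpermK i i') ri tpermR.
rewrite {r}ri tpermL in nst *; rewrite /= mul1r.
suff [nst_i nst_i' nwji] :
    [/\ ~~ star w i j, ~~ star w i' j & i != w j].
  by rewrite !PE // (negPf nwji) mulr0 addr0.
rewrite !starE //; have [le_i'|lt_i'] := leqP (alpha w (w j)) (alpha w i').
  have lt_i := leq_ltn_trans le_i' desc.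
  rewrite (leq_gtF (ltnW lt_i)); split=> //.
  by apply: contraTneq lt_i => <-; rewrite ltnn.
move: nst; rewrite lt_i' /= negb_imply -leqNgt => /andP[-> le_i].
have nwji' : i' != w j by apply: contraTneq lt_i' => <-; rewrite ltnn.
have nwji : i != w j.
  by apply: contraTneq le_i => <-; rewrite tpermL succ_i ltnn.
rewrite tpermD // in le_i.
by rewrite /= succ_i (leq_gtF le_i) (leq_gtF (leqW le_i)) !andbF.
Qed.

Lemma pattern_unswap w (P : 'M[C]_(k, n)) : fubini w ->
  (alpha w i' < alpha w i)%N -> pattern (swap i i' w) P ->
  exists t, pattern w (row_op t *m (s *m P)).
Proof.
move=> fw desc PP.
have PE q j : ~~ star (swap i i' w) q j -> P q j = (tperm i i' q == w j)%:R.
  by move/PP=> ->; rewrite mxE ffunE -(inj_eq (@perm_inj _ (tperm i i'))) tpermK.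
(* The entry to clear is the one in row i of the initial column of i' in the
   swapped word: it is a star there, but not in [w]. *)
have [j0 ij0] := alpha_is_position i fw.
exists (- P i j0) => r j; rewrite starE // => nst.
rewrite row_opE !tperm_mxE tpermL mxE.
have [ri|nri] := eqVneq r i'; last first.
  rewrite /= !mul0r addr0 PE ?tpermK // star_swap // tpermK.
  apply: contra nst => /andP[lt_r init].
  rewrite lt_r; apply/implyP => /(implyP init) rwj.
  rewrite -[r](tpermK i i') -[w j](tpermK i i') tperm_ltn // -negb_and.
  apply/negP => /andP[/eqP ri _]; move: nri.
  by rewrite -[r](tpermK i i') ri tpermL eqxx.
rewrite {r}ri tpermR in nst *; rewrite /= mul1r.
have [/andP[/eqP wj /eqP jj]|nj] := boolP ((w j == i) && (alpha w i == j)).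
  have -> : j0 = j by apply: val_inj; rewrite /= -ij0.
  rewrite [P i' j]PE ?tpermR ?wj ?eqxx ?mulr1 ?subrr.
    by rewrite -val_eqE /= succ_i gtn_eqF.
  by rewrite star_swap // wj tpermR ltnn.
(* In columns other than [j0], row [i'] of [P] is zero wherever row [i'] of the pattern of [w] is
   fixed, so the clearing has no effect there. *)
suff [nst_i nst_i' nwji] :
    [/\ ~~ star (swap i i' w) i j, ~~ star (swap i i' w) i' j & i != w j].
  by rewrite [P i j]PE // [P i' j]PE // tpermL tpermR (negPf nwji) mulr0 addr0.
rewrite !star_swap // tpermL tpermR.
have [le_i'|lt_i'] := leqP (alpha w (w j)) (alpha w i').
  have lt_i := leq_ltn_trans le_i' desc.
  rewrite (leq_gtF (ltnW lt_i)); split=> //.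
  by apply: contraTneq lt_i => <-; rewrite ltnn.
move: nst; rewrite lt_i' /= negb_imply -leqNgt => /andP[/eqP init le_i'].
have nwji : i != w j.
  by apply: contra nj => /eqP wj; rewrite -wj eqxx wj init eqxx.
have nwji' : i' != w j by apply: contraTneq lt_i' => <-; rewrite ltnn.
have le_i : (w j <= i)%N by rewrite -ltnS -succ_i ltn_neqAle val_eqE eq_sym nwji'.
by rewrite tpermD // init eqxx /= succ_i (leq_gtF le_i) (leq_gtF (leqW le_i)) !andbF.
Qed.

Lemma PR_cell_swap (us : s \in unitmx) w A :
  fubini w -> (alpha w i' < alpha w i)%N ->
  PR_cell w (\pi_(Xkn R k n) A) ->
  PR_cell (swap i i' w) (\pi_(Xkn R k n) (lact us A)).
Proof.
move=> fw desc [u [P [B [lu PP BE AB]]]].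
(* Right multiplication by [row_op (- t)] subtracts [t] times column [i'] from column [i]; as
   [u i' i' = 1], entry [(i', i)] of [u'] vanishes. *)
pose t := u i' i; pose u' := u *m row_op (- t).
exists (s *m u' *m s), (s *m (row_op t *m P)), (lact us B); split.
- apply: conj_lower_unitriangular.
    exact/lower_unitriangularM/row_op_lower_unitriangular.
  rewrite /u' mulmxDr mulmx1 -scalemxAr 3!mxE (bigD1 i') //= mxE !eqxx mulr1.
  rewrite (lu.2 i') big1 ?addr0 ?mulr1 ?subrr // => l li.
  by rewrite mxE (negPf li) mulr0.
- exact: pattern_swap.
- rewrite /= BE /u' -!mulmxA (mulmxA s s) tperm_mxK mul1mx.
  by rewrite (mulmxA (row_op (- t))) -{2}[t]opprK row_opK mul1mx.
- exact: lact_pi.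
Qed.

(** Here [row_op c] is split off on the left of the unitriangular factor; it cannot cross [s], so a
    factor from [U] stays outside. *)
Lemma PR_cell_unswap (us : s \in unitmx) w x :
  fubini w -> (alpha w i' < alpha w i)%N ->
  PR_cell (swap i i' w) x ->
  exists u (uu : u \in unitmx) A,
    [/\ lower_unitriangular u, PR_cell w (\pi_(Xkn R k n) A) &
        x = \pi_(Xkn R k n) (lact uu (lact us A))].
Proof.
move=> fw desc [u [P [B [lu PP BE ->]]]].
have [t PP'] := pattern_unswap fw desc PP.
pose c := u i' i; pose u' := row_op (- c) *m u.
have lu' : lower_unitriangular u'.
  exact/lower_unitriangularM/lu/row_op_lower_unitriangular.
have lc := row_op_lower_unitriangular c.
have uc := lower_unitriangular_unitmx lc.
have uc' := lower_unitriangular_unitmx (row_op_lower_unitriangular (- c)).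
pose A := lact us (lact uc' B).
exists (row_op c), uc, A; split=> //; last first.
  congr (\pi_(_) _); apply: val_inj => /=.
  by rewrite (mulmxA s) tperm_mxK mul1mx mulmxA row_opK mul1mx.
(* The matrix of [A] is [s u' P = (s u' s) row_op(-t) (row_op(t) s P)], whose last factor fits the
   pattern of [w]. *)
exists (s *m u' *m s *m row_op (- t)), (row_op t *m (s *m P)), A; split=> //.
- apply: lower_unitriangularM; last exact: row_op_lower_unitriangular.
  apply: conj_lower_unitriangular => //.
  have /= := lu.2 i => ui; rewrite row_opE eqxx mul1r ui mulr1.
  by rewrite -/c subrr.
- rewrite /= BE -!mulmxA (mulmxA (row_op (- t))) -{2}[t]opprK row_opK mul1mx.
  by rewrite (mulmxA s s) tperm_mxK mul1mx /u' !mulmxA.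
Qed.

End Cells.

Theorem theorem4p3 (R : realType) (n k : nat) (k_gt0 : (1 <= k)%N)
    (le_kn : (k <= n)%N) (v w : {ffun 'I_n -> 'I_k})
    (fub_v : fubini v) (fub_w : fubini w)
    (i i' : 'I_k) (succ_i : i' = i.+1 :> nat)
    (desc_v : (alpha v i' < alpha v i)%N)
    (desc_w : (alpha w i' < alpha w i)%N) :
  (medium_roast_le R v w -> medium_roast_le R (swap i i' v) (swap i i' w)) /\
  (touches R v w -> touches R (swap i i' v) (swap i i' w)).
Proof.
have us : tperm_mx i i' \in @unitmx R[i] k by apply: unitmx_perm.
have swap_closure := zariski_closure_lact
  (fun A => PR_cell_swap (A := A) succ_i us fub_v desc_v).
split=> [vw x /(PR_cell_unswap succ_i us fub_w desc_w)|].
  move=> [u [uu [A [lu wA ->]]]].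
  (* The cell of [swap i i' v] is stable under [U], hence so is its closure, which absorbs the
     factor [u]. *)
  apply: (zariski_closure_lact (Z := PR_cell (swap i i' v))).
    by move=> B; apply: PR_cell_lact.
  by apply: swap_closure; exact: vw.
move=> [x [vx wx]]; rewrite -[x]reprK in vx wx.
exists (\pi_(Xkn R k n) (lact us (repr x))).
by split; [apply: swap_closure | apply: PR_cell_swap].
Qed.
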